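(* Let $m,n\ge 1$ and $k\ge 0$ be integers, and let $S_{m,n,k}$ be the set of walks of length $k$ that a chess rook can move along on a rectangular board of width $m$ and height $n$, starting and ending on the bottom left square. Then $$|S_{m,n,k}|=\frac{(m+n-2)^k + (n-1)(m-2)^k + (m-1)(n-2)^k + (m-1)(n-1)(-2)^k}{mn}.$$
   Context: The board is the set of squares $\{0,\dots,m-1\}\times\{0,\dots,n-1\}$, with bottom left square $(0,0)$. A rook move goes from a square to a different square in the same row or the same column (any distance; there are no obstructions). A walk of length $k$ is a sequence of squares $(p_0,p_1,\dots,p_k)$ such that each step from $p_{j-1}$ to $p_j$ is a rook move; $S_{m,n,k}$ consists of those with $p_0=p_k=(0,0)$. The convention $0^0=1$ is used. *)

(* Defs.v *)
From mathcomp Require Import all_boot all_order all_algebra.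
Set Implicit Arguments. Unset Strict Implicit. Unset Printing Implicit Defensive.

(* The first coordinate is the column (width m), the second the row (height n). *)
Definition square (m n : nat) : finType := ('I_m * 'I_n)%type.

Definition rook_move (m n : nat) : rel (square m n) :=
  fun p q => (p != q) && ((p.1 == q.1) || (p.2 == q.2)).

(* A predicate rather than an element, since 'I_m has no zero when m = 0. *)
Definition bottom_left (m n : nat) : pred (square m n) :=
  fun p => (nat_of_ord p.1 == 0) && (nat_of_ord p.2 == 0).

Definition rook_walk (m n k : nat) (w : k.+1.-tuple (square m n)) : bool :=
  sorted (@rook_move m n) w.

Definition closed_rook_walks (m n k : nat) : {set k.+1.-tuple (square m n)} :=
  [set w | [&& rook_walk w, bottom_left (tnth w ord0)
             & bottom_left (tnth w ord_max)]].

(* Main.v *)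
Require Import Defs.
From mathcomp Require Import all_boot all_order all_algebra.
From mathcomp Require Import ring.
Import Order.TTheory GRing.Theory Num.Theory.
Local Open Scope ring_scope.

(** The number of walks of length [k] from [p] to a fixed target is the value at
    [p] of [A ^+ k] applied to the indicator of the target, [A] being the
    adjacency operator.  So it suffices to write that indicator as a sum of
    eigenfunctions of [A]; this is [walks_to_spectral].

    For the rook, [A f (x, y)] is the sum of [f] over the row of [(x, y)], plus
    the sum over its column, minus [2 * f (x, y)] ([sum_rook_move]).  The row
    and the column sums act on separate coordinates, so products of
    eigenfunctions of the one-dimensional operator replacing a function on
    ['I_m] by its total sum are eigenfunctions of [A].  That operator has the
    eigenvalue [m] on constants and [0] on functions of sum zero.  The indicator
    of [0] is the constant [m^-1] plus a function of sum zero
    ([corner_part]), and the indicator of the corner square is the product of two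
    such indicators.  Expanding the product gives four eigenfunctions, with
    eigenvalues [m + n - 2], [m - 2], [n - 2] and [- 2]; their values at the
    corner are the four coefficients of the formula. *)

Lemma card_tupleS {T : finType} (k : nat) (P : pred (k.+1.-tuple T)) :
  #|[set w | P w]|
  = (\sum_(x : T) #|[set s : k.-tuple T | P [tuple of x :: s]]|)%N.
Proof.
rewrite -sum1_card big_mkcond /=.
rewrite (reindex (fun p : T * k.-tuple T => [tuple of p.1 :: p.2])) /=; last first.
  exists (fun w => (thead w, [tuple of behead w])) => [[x s]|w] _ /=.
    by congr pair; apply: val_inj.
  by rewrite [w in RHS]tuple_eta; apply: val_inj.
rewrite -(pair_bigA _ (fun x (s : k.-tuple T) =>
  if [tuple of x :: s] \in [set w | P w] then 1 else 0)%N) /=.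
apply: eq_bigr => x _; rewrite -big_mkcond -sum1_card.
by apply: eq_bigl => s; rewrite !inE.
Qed.

Definition walks_to {T : finType} (e : rel T) (Q : pred T) (k : nat) (p : T) : nat :=
  #|[set s : k.-tuple T | path e p s && Q (last p s)]|.

Lemma walks_to0 {T : finType} (e : rel T) (Q : pred T) (p : T) :
  walks_to e Q 0 p = Q p.
Proof.
rewrite /walks_to; case Qp: (Q p).
  rewrite (_ : [set _ | _] = setT) ?cardsT ?card_tuple //.
  by apply/setP => s; rewrite !inE tuple0 /= Qp.
by apply: eq_card0 => s; rewrite !inE tuple0 /= Qp.
Qed.

Lemma walks_toS {T : finType} (e : rel T) (Q : pred T) (k : nat) (p : T) :
  walks_to e Q k.+1 p = (\sum_(r | e p r) walks_to e Q k r)%N.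
Proof.
rewrite /walks_to card_tupleS [RHS]big_mkcond /=; apply: eq_bigr => x _.
by case: (e p x) => //=; apply: eq_card0 => s; rewrite !inE.
Qed.

(** Each [g i] is an eigenfunction of the adjacency operator for the eigenvalue
    [l i], so [k] applications of the operator to the indicator of [Q] multiply
    its [g i] component by [l i ^+ k]. *)
Lemma walks_to_spectral {R : comNzRingType} {T I : finType} (e : rel T)
    (Q : pred T) (g : I -> T -> R) (l : I -> R) :
  (forall p, (Q p)%:R = \sum_i g i p) ->
  (forall i p, \sum_(r | e p r) g i r = l i * g i p) ->
  forall k p, (walks_to e Q k p)%:R = \sum_i l i ^+ k * g i p.
Proof.
move=> gQ ge; elim=> [|k IHk] p.
  by rewrite walks_to0 gQ; apply: eq_bigr => i _; rewrite expr0 mul1r.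
rewrite walks_toS natr_sum (eq_bigr _ (fun r _ => IHk r)) exchange_big /=.
by apply: eq_bigr => i _; rewrite -mulr_sumr ge exprSr mulrA.
Qed.

(** The square [p] itself is counted once in its row and once in its column,
    although it is not a rook move away from itself. *)
Lemma sum_rook_move (V : zmodType) (m n : nat) (f : square m n -> V)
    (p : square m n) :
  \sum_(r | rook_move p r) f r
  = \sum_x f (x, p.2) + \sum_y f (p.1, y) - f p *+ 2.
Proof.
case: p => a b /=.
have row : \sum_x f (x, b) = \sum_(r : square m n | r.2 == b) f r.
  rewrite (reindex_onto (fun x : 'I_m => (x, b)) fst) /=; last first.
    by case=> x y /= /eqP->.
  by apply: eq_bigl => x; rewrite /= !eqxx.
have col : \sum_y f (a, y) = \sum_(r : square m n | r.1 == a) f r.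
  rewrite (reindex_onto (fun y : 'I_n => (a, y)) snd) /=; last first.
    by case=> x y /= /eqP->.
  by apply: eq_bigl => y; rewrite /= !eqxx.
rewrite row col [X in X + _ - _](bigD1 (a, b)) //= [X in _ + X - _](bigD1 (a, b)) //=.
rewrite mulr2n addrACA [RHS]addrC addKr.
rewrite (bigID (fun r : square m n => r.2 == b)) /=; congr (_ + _);
  apply: eq_bigl => -[x y]; rewrite /rook_move !xpair_eqE /=.
  by rewrite (eq_sym a) (eq_sym b); case: (x == a); case: (y == b).
by rewrite (eq_sym a) (eq_sym b); case: (x == a); case: (y == b).
Qed.

(** The constant part ([a = true]) and the part of sum zero ([a = false]) of the
    indicator of [0] on ['I_m]. *)
Definition corner_part {m : nat} (a : bool) (x : 'I_m) : rat :=
  if a then m%:R^-1 else (nat_of_ord x == 0)%:R - m%:R^-1.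

Lemma sum_corner_part_parts (m : nat) (x : 'I_m) :
  \sum_a corner_part a x = (nat_of_ord x == 0)%:R.
Proof. by rewrite big_bool /= addrC subrK. Qed.

Lemma sum_corner_part (m : nat) (a : bool) (y : 'I_m) :
  \sum_(x < m) corner_part a x = (a * m)%:R * corner_part a y.
Proof.
case: m y => [[]//|m] y; case: a => /=.
  by rewrite mul1n sumr_const card_ord mulr_natl.
rewrite mul0n mul0r sumrB sumr_const card_ord -[X in _ - X]mulr_natl divff ?pnatr_eq0 //.
by rewrite big_ord_recl big1 ?addr0 ?subrr.
Qed.

Lemma rook_move_eigen (m n : nat) (i : bool * bool) (p : square m n) :
  \sum_(r | rook_move p r) corner_part i.1 r.1 * corner_part i.2 r.2
  = ((i.1 * m)%:R + (i.2 * n)%:R - 2)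
    * (corner_part i.1 p.1 * corner_part i.2 p.2).
Proof.
rewrite (sum_rook_move _ _ _ (fun r => corner_part i.1 r.1 * corner_part i.2 r.2)) /=.
rewrite -mulr_suml -mulr_sumr (sum_corner_part _ _ p.1) (sum_corner_part _ _ p.2).
ring.
Qed.

Lemma bottom_left_parts (m n : nat) (p : square m n) :
  (bottom_left p)%:R
  = \sum_(i : bool * bool) corner_part i.1 p.1 * corner_part i.2 p.2.
Proof.
rewrite -(pair_bigA _ (fun a b => corner_part a p.1 * corner_part b p.2)) /=.
by rewrite -big_distrlr /= !sum_corner_part_parts -natrM mulnb.
Qed.

Lemma card_closed_rook_walks (m n k : nat) :
  #|closed_rook_walks m.+1 n.+1 k|
  = walks_to (@rook_move m.+1 n.+1) (@bottom_left m.+1 n.+1) k (ord0, ord0).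
Proof.
rewrite /closed_rook_walks card_tupleS (bigD1 (ord0, ord0)) //= [X in (_ + X)%N]big1.
  rewrite addn0; apply: eq_card => s; rewrite !inE /rook_walk /=.
  by rewrite (tnth_nth (ord0, ord0)) /= -[k in nth _ _ k](size_tuple s) nth_last.
move=> [x y] xy0; apply: eq_card0 => s; rewrite !inE /bottom_left tnth0 /=.
by move: xy0; rewrite xpair_eqE -!val_eqE /= => /negbTE->; rewrite andbF.
Qed.

Theorem theorem1p3 (m n k : nat) (hm : (1 <= m)%N) (hn : (1 <= n)%N) :
  #|closed_rook_walks m n k|%:R =
  ((m%:R + n%:R - 2) ^+ k
   + (n%:R - 1) * (m%:R - 2) ^+ k
   + (m%:R - 1) * (n%:R - 2) ^+ k
   + (m%:R - 1) * (n%:R - 1) * (- 2) ^+ k) / (m%:R * n%:R) :> rat.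
Proof.
case: m hm => // m _; case: n hn => // n _.
rewrite card_closed_rook_walks.
rewrite (walks_to_spectral _ _ _ _ (bottom_left_parts _ _) (rook_move_eigen _ _)).
rewrite -(pair_bigA _ (fun a b : bool => ((a * m.+1)%:R + (b * n.+1)%:R - 2) ^+ k
  * (corner_part a (ord0 : 'I_m.+1) * corner_part b (ord0 : 'I_n.+1)))) /=.
rewrite !big_bool /= !mul1n !mul0n !add0r !addr0.
have m0 : m.+1%:R != 0 :> rat by rewrite pnatr_eq0.
have n0 : n.+1%:R != 0 :> rat by rewrite pnatr_eq0.
(* Hiding the casts keeps [field] from expanding the successors. *)
move: m.+1%:R n.+1%:R m0 n0 => M N M0 N0.
by field; rewrite M0 N0.
Qed.
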